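(* Let $f:\mathbb{C}[x,y]\to\mathbb{C}[x,y]$ be a morphism that satisfies $\operatorname{Jac}(f(x),f(y))\in\mathbb{C}^*$. If the degree of $f(x)$ or the degree of $f(y)$ is $\leq 2$, then $f$ is invertible.
   Context: A morphism of $\mathbb{C}[x,y]$ is a $\mathbb{C}$-algebra endomorphism of $\mathbb{C}[x,y]$. For $A,B\in\mathbb{C}[x,y]$, $\operatorname{Jac}(A,B)=\frac{\partial A}{\partial x}\frac{\partial B}{\partial y}-\frac{\partial A}{\partial y}\frac{\partial B}{\partial x}$. The degree of a polynomial is its total degree (its $(1,1)$-degree). A morphism $f$ is invertible if there is a morphism $h$ of $\mathbb{C}[x,y]$ with $fh=hf=1$, the identity morphism. $\mathbb{C}^*=\mathbb{C}\setminus\{0\}$. *)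

(* Defs.v *)
From HB Require Import structures.
From mathcomp Require Import all_boot all_order all_algebra.
From mathcomp Require Import reals.
From mathcomp Require Export complex mpoly.
Set Implicit Arguments.
Unset Strict Implicit.
Unset Printing Implicit Defensive.
Import GRing.Theory.
Local Open Scope ring_scope.

Section PlanePolynomials.
Variable C : fieldType.

(* The two variables x and y are those of index 0 and 1 in 'I_2. *)
Definition varx : {mpoly C[2]} := 'X_ord0.
Definition vary : {mpoly C[2]} := 'X_ord_max.

Definition Jac (A B : {mpoly C[2]}) : {mpoly C[2]} :=
  A^`M(ord0) * B^`M(ord_max) - A^`M(ord_max) * B^`M(ord0).

(* [msize] is one more than the total degree for nonzero polynomials;
   the zero polynomial is given total degree 0. *)
Definition total_degree (A : {mpoly C[2]}) : nat := (msize A).-1.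

Definition endomorphism := {lrmorphism {mpoly C[2]} -> {mpoly C[2]}}.

Definition invertible (f : endomorphism) : Prop :=
  exists h : endomorphism, f \o h =1 id /\ h \o f =1 id.

End PlanePolynomials.

Arguments varx {C}.
Arguments vary {C}.

(* Main.v *)
(** Say [A := f x] is the component of degree at most 2. The Jacobian is a nonzero
    constant, so the gradient of [A], an affine map of the plane, has no zero.
    Hence [A = v + s u^2 + d] with [u], [v] independent linear forms, and
    [phi : x |-> A, y |-> u] is an automorphism. The morphism [phi^-1 f] fixes [x]
    and, by the chain rule, sends [y] to [k y + g(x)] with [k != 0]. *)
Require Import Defs.
From mathcomp Require Import all_boot all_order all_algebra.
From mathcomp Require Import reals.
From mathcomp Require Import ring.
Local Open Scope ring_scope.

Set Implicit Arguments.
Unset Strict Implicit.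
Unset Printing Implicit Defensive.
Import GRing.Theory.

Section PlaneMorphisms.
Variable C : fieldType.
Implicit Types (f g h : endomorphism C) (p q A B : {mpoly C[2]}).

(** * Endomorphisms and their values on the two variables *)

Lemma mpolyX2 (m : 'X_{1..2}) :
  'X_[m] = varx ^+ m ord0 * vary ^+ m ord_max :> {mpoly C[2]}.
Proof.
rewrite mpolyXE_id big_ord_recr big_ord1.
by congr ('X_ _ ^+ m _ * _); apply: val_inj.
Qed.

Lemma endomorphismC f c : f c%:MP = c%:MP.
Proof. by rewrite -[c%:MP]mulr1 mul_mpolyC linearZ rmorph1. Qed.

Lemma endomorphism_eq f g : f varx = g varx -> f vary = g vary -> f =1 g.
Proof.
move=> fgx fgy p; rewrite (mpolyE p) !linear_sum; apply: eq_bigr => m _.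
by rewrite !linearZ /= mpolyX2 !(rmorphM, rmorphXn) /= fgx fgy.
Qed.

Definition subst p q : endomorphism C := comp_mpoly [tuple p; q].

Lemma substx p q : subst p q varx = p.
Proof. exact: comp_mpolyXU. Qed.

Lemma substy p q : subst p q vary = q.
Proof. exact: comp_mpolyXU. Qed.

Lemma invertibleP f h :
  f (h varx) = varx -> f (h vary) = vary ->
  h (f varx) = varx -> h (f vary) = vary -> invertible f.
Proof.
move=> fhx fhy hfx hfy; exists h; split => p /=.
  exact: (@endomorphism_eq (f \o h) idfun).
exact: (@endomorphism_eq (h \o f) idfun).
Qed.

Lemma invertible_comp f g : invertible f -> invertible g -> invertible (f \o g).
Proof.
move=> [f' [ff' f'f]] [g' [gg' g'g]]; exists (g' \o f'); split => p /=.
  by have /= -> := gg' (f' p); apply: ff'.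
by have /= -> := f'f (g p); apply: g'g.
Qed.

Lemma invertible_ext f g : f =1 g -> invertible f -> invertible g.
Proof.
move=> fg [h [fh hf]]; exists h; split=> p /=; rewrite -fg; first exact: fh.
exact: hf.
Qed.

(** * Partial derivatives and the Jacobian of a composition *)

Lemma mderivXU i j : ('X_j : {mpoly C[2]})^`M(i) = (i == j)%:R.
Proof.
rewrite mderivX mnm1E eq_sym; case: eqP => [->|_]; last by rewrite scale0r.
have -> : (U_(j) - U_(j) = 0 :> 'X_{1..2})%MM.
  by apply/mnmP => k; rewrite mnmBE subnn mnm0E.
by rewrite mpolyX0 scale1r.
Qed.

Lemma mderiv_varx i : varx^`M(i) = (i == ord0)%:R :> {mpoly C[2]}.
Proof. exact: mderivXU. Qed.

Lemma mderiv_vary i : vary^`M(i) = (i == ord_max)%:R :> {mpoly C[2]}.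
Proof. exact: mderivXU. Qed.

Lemma JacN p q : Jac p q = - Jac q p.
Proof. by rewrite /Jac; ring. Qed.

Lemma mderiv_exp i p n : (p ^+ n)^`M(i) = p ^+ n.-1 *+ n * p^`M(i).
Proof.
elim: n => [|n IHn]; first by rewrite expr0 mulr0n mul0r -mpolyC1 mderivC.
rewrite exprS mderivM IHn /=; case: n {IHn} => [|n] /=.
  by rewrite !expr0 mulr0n mul0r mulr0 addr0 mulr1 mul1r.
by rewrite [in RHS]mulrS exprS; ring.
Qed.

(** Both sides are linear in [p], which reduces the identity to monomials; there it follows from the
    Leibniz and power rules. *)
Lemma chain_rule f i p :
  (f p)^`M(i) = f p^`M(ord0) * (f varx)^`M(i)
              + f p^`M(ord_max) * (f vary)^`M(i).
Proof.
elim/mpolyind: p => [|c m p _ _ IHp].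
  by rewrite !(mderiv0, raddf0) !mul0r addr0.
rewrite !(mderivD, rmorphD) /= IHp !(mderivZ, linearZ) /=.
suff -> : (f 'X_[m])^`M(i) = f 'X_[m]^`M(ord0) * (f varx)^`M(i)
                         + f 'X_[m]^`M(ord_max) * (f vary)^`M(i).
  by rewrite -!mul_mpolyC; ring.
rewrite mpolyX2 !(rmorphM, rmorphXn, mderivM, mderiv_exp) /=.
rewrite !(mderiv_varx, mderiv_vary) /= !(rmorphD, rmorphM, rmorphMn, rmorphXn).
by rewrite !(rmorph0, rmorph1) /=; ring.
Qed.

(** By the chain rule the Jacobian matrix is a product of two matrices, and the determinant is
    multiplicative. *)
Lemma Jac_morph f p q : Jac (f p) (f q) = f (Jac p q) * Jac (f varx) (f vary).
Proof.
rewrite /Jac !(chain_rule f _ p) !(chain_rule f _ q) rmorphB !rmorphM /=.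
by ring.
Qed.

(** * Triangular morphisms in characteristic zero *)

Hypothesis char0 : [pchar C] =i pred0.

(** In characteristic zero, a vanishing [y]-derivative means that no monomial of [q] involves [y],
    so [q] is a polynomial in [x] alone. *)
Lemma mderivy_eq0_fixed f q :
  f varx = varx -> q^`M(ord_max) = 0 -> f q = q.
Proof.
move=> fx qy; rewrite (mpolyE q) linear_sum; apply: eq_big_seq => m m_q.
rewrite linearZ /= mpolyX2 rmorphM !rmorphXn /= fx.
suff -> : m ord_max = 0%N by rewrite !expr0.
apply/eqP; apply: contraLR m_q => m1.
(* This coefficient is a positive integer multiple of [q@_m]. *)
have: q^`M(ord_max)@_(m - U_(ord_max)) == 0 by rewrite qy mcoeff0.
rewrite mcoeff_mderiv submK; last first.
  by apply/mnm_lepP => i; rewrite mnm1E; case: eqP => // <-; rewrite lt0n.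
rewrite -mulr_natr mulf_eq0 ((pcharf0P C).1 char0) orbF => /eqP m0.
by rewrite mcoeff_msupp m0 eqxx.
Qed.

(** Such an [f] sends [y] to [k y + g(x)]; solving for [y] gives the inverse
    [y |-> (y - g(x)) / k]. *)
Lemma triangular_invertible f (k : C) :
  f varx = varx -> k != 0 -> (f vary)^`M(ord_max) = k%:MP -> invertible f.
Proof.
move=> fx k0 fy; pose g := f vary - k%:MP * vary.
have gy : g^`M(ord_max) = 0.
  by rewrite mderivB mderiv_mulC mderiv_vary fy mulr1 subrr.
have fyE : f vary = k%:MP * vary + g by rewrite addrC subrK.
have kV : k^-1%:MP * k%:MP = 1 :> {mpoly C[2]} by rewrite -mpolyCM mulVf.
apply: (@invertibleP _ (subst varx (k^-1%:MP * (vary - g)))).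
- by rewrite substx.
- rewrite substy rmorphM rmorphB /= endomorphismC.
  by rewrite (mderivy_eq0_fixed fx gy) fyE addrK mulrA kV mul1r.
- by rewrite fx substx.
rewrite fyE rmorphD rmorphM /= endomorphismC substy.
rewrite (mderivy_eq0_fixed _ gy) ?substx // mulrA [_ * k^-1%:MP]mulrC kV.
by rewrite mul1r subrK.
Qed.

(** * Polynomials of degree at most two *)

Lemma mcoeffXY (m : 'X_{1..2}) i j :
  (varx ^+ i * vary ^+ j : {mpoly C[2]})@_m
    = ((m ord0 == i) && (m ord_max == j))%:R.
Proof.
pose k : 'X_{1..2} := [multinom [tuple i; j]].
have k0 : k ord0 = i by rewrite multinomE.
have k1 : k ord_max = j by rewrite multinomE.
clearbody k; rewrite -k0 -k1 -mpolyX2 mcoeffX; congr (nat_of_bool _)%:R.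
apply/eqP/andP => [-> // | [/eqP m0 /eqP m1]]; apply/mnmP => l.
have /orP[/eqP -> | /eqP ->] : (l == ord0) || (l == ord_max).
  by case: l => [[|[|]]].
- by rewrite m0.
by rewrite m1.
Qed.

Lemma quadratic_expansion A : (total_degree A <= 2)%N ->
  exists d l1 l2 q11 q12 q22 : C, A = d%:MP + l1%:MP * varx + l2%:MP * vary
    + q11%:MP * varx ^+ 2 + q12%:MP * (varx * vary) + q22%:MP * vary ^+ 2.
Proof.
move=> degA.
(* Coefficients become a function of two natural numbers, so that the comparison below is a finite
   case analysis on the exponents. *)
have [cf cfE] : exists cf, forall m, A@_m = cf (m ord0) (m ord_max).
  exists (fun i j => A@_[multinom [tuple i; j]]) => m; congr (A@__).
  apply/mnmP => l; rewrite multinomE.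
  by case: l => [[|[|//]]] ?; congr (m _); apply: val_inj.
have cf0 (m : 'X_{1..2}) : (2 < m ord0 + m ord_max)%N -> cf (m ord0) (m ord_max) = 0.
  move=> m_gt2; rewrite -(cfE m); apply/memN_msupp_eq0/msize_mdeg_ge.
  rewrite mdegE big_ord_recr big_ord1 /=.
  have -> : widen_ord (leqnSn 1) ord0 = ord0 by apply: val_inj.
  by apply: leq_trans m_gt2; apply: leq_trans (leqSpred _) _; rewrite ltnS.
suff AE : A = cf 0 0 *: (varx ^+ 0 * vary ^+ 0)
    + cf 1 0 *: (varx ^+ 1 * vary ^+ 0) + cf 0 1 *: (varx ^+ 0 * vary ^+ 1)
    + cf 2 0 *: (varx ^+ 2 * vary ^+ 0) + cf 1 1 *: (varx ^+ 1 * vary ^+ 1)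
    + cf 0 2 *: (varx ^+ 0 * vary ^+ 2).
  exists (cf 0 0), (cf 1 0), (cf 0 1), (cf 2 0), (cf 1 1), (cf 0 2).
  by rewrite {}AE -!mul_mpolyC !expr0 !expr1 !mulr1 !mul1r.
apply/mpolyP => m; rewrite !(mcoeffD, mcoeffZ) !mcoeffXY cfE.
move: (m ord0) (m ord_max) (cf0 m) => i j.
have [ij /(_ isT) ->|ij _] := leqP 3 (i + j).
  by case: i j ij => [|[|[|i]]] [|[|[|j]]] //= _; rewrite !(mulr0, addr0).
case: i j ij => [|[|[|i]]] [|[|[|j]]] //= _;
  by rewrite !(mulr0, mulr1, addr0, add0r).
Qed.

(* The linear part of the gradient of [A] has rank at most 1, as otherwise the
   gradient would vanish somewhere; its discriminant is [4 q11 q22 - q12 ^ 2]. *)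
Lemma quadratic_normal_form A B (c : C) :
  (total_degree A <= 2)%N -> c != 0 -> Jac A B = c%:MP ->
  exists a b e g s d : C, a * g - b * e != 0 /\
    A = a%:MP * varx + b%:MP * vary
        + s%:MP * (e%:MP * varx + g%:MP * vary) ^+ 2 + d%:MP.
Proof.
move=> /quadratic_expansion[d [l1 [l2 [q11 [q12 [q22 AE]]]]]] c0 JAB.
have two0 : 2%:R != 0 :> C by rewrite ((pcharf0P C).1 char0).
(* The two affine expressions are the partial derivatives of [A] at [(x, y)]; a common zero would
   make the Jacobian, hence [c], vanish. *)
have no_zero x y : ~ (l1 + 2%:R * q11 * x + q12 * y = 0 /\
                      l2 + q12 * x + 2%:R * q22 * y = 0).
  pose v : 'I_2 -> C := tnth [tuple x; y].
  have vx : varx.@[v] = x by rewrite mevalXU.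
  have vy : vary.@[v] = y by rewrite mevalXU.
  case=> gx gy; case/eqP: c0.
  have := congr1 (meval v) JAB; rewrite mevalC /Jac mevalB !mevalM.
  have -> : A^`M(ord0).@[v] = 0.
    rewrite AE !(mderivD, mderivC, mderiv_mulC, mderiv_exp, mderivM).
    rewrite !(mderiv_varx, mderiv_vary) /=.
    rewrite !(mevalD, mevalM, mevalC, meval0, meval1, mevalMn, vx, vy) -[RHS]gx.
    by ring.
  have -> : A^`M(ord_max).@[v] = 0.
    rewrite AE !(mderivD, mderivC, mderiv_mulC, mderiv_exp, mderivM).
    rewrite !(mderiv_varx, mderiv_vary) /=.
    rewrite !(mevalD, mevalM, mevalC, meval0, meval1, mevalMn, vx, vy) -[RHS]gy.
    by ring.
  by rewrite !mul0r subrr => /esym.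
have det0 : 4%:R * q11 * q22 = q12 ^+ 2.
  apply/eqP; rewrite -subr_eq0; apply/negPn/negP => D0.
  (* With a nonzero discriminant, Cramer's rule yields this zero of the gradient. *)
  apply: (no_zero ((q12 * l2 - 2%:R * q22 * l1) / (4%:R * q11 * q22 - q12 ^+ 2))
                  ((q12 * l1 - 2%:R * q11 * l2) / (4%:R * q11 * q22 - q12 ^+ 2))).
  by split; field.
have [q11_0|q11_0] := eqVneq q11 0.
  have q12_0 : q12 = 0.
    by apply/eqP; rewrite -sqrf_eq0 -det0 q11_0 mulr0 mul0r.
  have [q22_0|q22_0] := eqVneq q22 0.
    (* Here [A] is affine: [s = 0], and the second form is [y] or [x], whichever is independent of
       the linear part. *)
    have [l1_0|l1_0] := eqVneq l1 0; last first.
      exists l1, l2, 0, 1, 0, d; split; first by rewrite mulr0 subr0 mulr1.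
      by rewrite AE q11_0 q12_0 q22_0; ring.
    exists l1, l2, 1, 0, 0, d; split; last first.
      by rewrite AE q11_0 q12_0 q22_0; ring.
    rewrite mulr0 mulr1 sub0r oppr_eq0; apply/eqP => l2_0.
    by apply: (no_zero 0 0); rewrite l1_0 l2_0; split; ring.
  (* The quadratic part is [q22 y^2]. If [l1 = 0], the gradient vanishes wherever
     [l2 + 2 q22 y = 0]. *)
  exists l1, l2, 0, 1, q22, d; split; last first.
    by rewrite AE q11_0 q12_0; ring.
  rewrite mulr0 mulr1 subr0; apply/eqP => l1_0.
  apply: (no_zero 0 (- l2 / (2%:R * q22))).
  by rewrite l1_0 q12_0; split; [ring|field; rewrite q22_0].
(* Completing the square: the quadratic part is [q11 (x + t y)^2]. *)
pose t := q12 / (2%:R * q11).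
have q12E : q12 = 2%:R * q11 * t by rewrite /t; field; rewrite q11_0.
have q22E : q22 = q11 * t ^+ 2.
  have q4 : 4%:R * q11 != 0.
    by rewrite mulf_neq0 // ((pcharf0P C).1 char0).
  by apply: (mulfI q4); rewrite det0 q12E; ring.
exists l1, l2, 1, t, q11, d; split; last by rewrite AE q12E q22E; ring.
rewrite mulr1; apply/eqP => D0.
(* If the two forms are dependent, the gradient is [l1 + 2 q11 (x + t y)] times [(1, t)], which has
   a zero on the [x]-axis. *)
have l2E : l2 = l1 * t by apply/esym/eqP; rewrite -subr_eq0 D0.
apply: (no_zero (- l1 / (2%:R * q11)) 0).
by rewrite q12E l2E; split; field; rewrite q11_0.
Qed.

Lemma quadratic_automorphism A B (c : C) :
  (total_degree A <= 2)%N -> c != 0 -> Jac A B = c%:MP ->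
  exists phi : endomorphism C, [/\ invertible phi, phi varx = A &
    exists2 k : C, k != 0 & Jac (phi varx) (phi vary) = k%:MP].
Proof.
move=> degA c0 /(quadratic_normal_form degA c0)[a [b [e [g [s [d [D0 AE]]]]]]].
pose u : {mpoly C[2]} := e%:MP * varx + g%:MP * vary.
pose k := a * g - b * e; pose i : {mpoly C[2]} := k^-1%:MP.
have ki : i * (a%:MP * g%:MP - b%:MP * e%:MP) = 1.
  by rewrite -!mpolyCM -mpolyCB -mpolyCM mulVf.
(* Removing the square and the constant: the morphism [x |-> A], [y |-> u] sends [w] to the linear
   form [a x + b y]. *)
pose w : {mpoly C[2]} := varx - s%:MP * vary ^+ 2 - d%:MP.
have wE h : h varx = A -> h vary = u -> h w = a%:MP * varx + b%:MP * vary.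
  move=> hx hy; rewrite !(rmorphB, rmorphM, rmorphXn) /= !endomorphismC hx hy.
  by rewrite AE /u; ring.
exists (subst A u); rewrite substx substy; split=> //; last first.
  exists k => //; rewrite /Jac AE /u.
  rewrite !(mderivD, mderivC, mderiv_mulC, mderiv_exp) !(mderiv_varx, mderiv_vary) /=.
  by rewrite /k !(mpolyCB, mpolyCM); ring.
(* The inverse recovers [x] and [y] from [a x + b y] and [u] by Cramer's rule, with determinant
   [k]. *)
pose h := subst (i * (g%:MP * w - b%:MP * vary)) (i * (a%:MP * vary - e%:MP * w)).
have hu : h u = vary.
  rewrite !(rmorphD, rmorphM) /= !endomorphismC substx substy.
  by rewrite -[RHS]mul1r -ki; ring.
have phiw := wE _ (substx A u) (substy A u).
apply: (@invertibleP _ h).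
- rewrite substx rmorphM rmorphB !rmorphM /= !endomorphismC phiw substy.
  by rewrite -[RHS]mul1r -ki /u /i; ring.
- rewrite substy rmorphM rmorphB !rmorphM /= !endomorphismC phiw substy.
  by rewrite -[RHS]mul1r -ki /u /i; ring.
- rewrite substx AE -/u 3!rmorphD !rmorphM /= hu !endomorphismC.
  rewrite substx substy.
  transitivity (i * (a%:MP * g%:MP - b%:MP * e%:MP) * w + s%:MP * vary ^+ 2 + d%:MP).
    by ring.
  by rewrite ki /w; ring.
by rewrite substy.
Qed.

(** * Reduction to the triangular case *)

Lemma invertible_of_degree_le2 f (c : C) : c != 0 ->
  Jac (f varx) (f vary) = c%:MP -> (total_degree (f varx) <= 2)%N ->
  invertible f.
Proof.
move=> c0 Jf degx.
have [phi [inv_phi phix [k k0 Jphi]]] := quadratic_automorphism degx c0 Jf.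
have [psi [phipsi psiphi]] := inv_phi.
pose f' : endomorphism C := psi \o f.
have f'x : f' varx = varx by rewrite /= -phix; apply: psiphi.
have phif' p : phi (f' p) = f p by apply: phipsi.
suff inv_f' : invertible f'.
  exact: (@invertible_ext (phi \o f') f phif' (invertible_comp inv_phi inv_f')).
(* The chain rule for [phi] and [f'] gives [phi(J) * k = c], where [J] is the [y]-derivative of
   [f' vary]; applying [psi] gives [J = c / k]. *)
apply: (@triangular_invertible _ (c / k)); rewrite ?mulf_neq0 ?invr_eq0 //.
rewrite -[LHS]psiphi -[RHS](endomorphismC psi) /=; congr (psi _).
have: Jac (phi (f' varx)) (phi (f' vary)) = c%:MP by rewrite !phif'.
rewrite Jac_morph Jphi {1}/Jac f'x !mderiv_varx /= mul1r mul0r subr0 => E.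
rewrite -[LHS]mulr1 -mpolyC1 -(divff k0) mpolyCM mulrA E -mpolyCM //.
Qed.

Lemma swap_invertible : invertible (subst (vary : {mpoly C[2]}) varx).
Proof.
by apply: (@invertibleP _ (subst vary varx)); rewrite !(substx, substy).
Qed.

Lemma low_degree_invertible f (c : C) : c != 0 ->
  Jac (f varx) (f vary) = c%:MP ->
  (total_degree (f varx) <= 2)%N \/ (total_degree (f vary) <= 2)%N ->
  invertible f.
Proof.
move=> c0 Jf [degx|degy]; first exact: invertible_of_degree_le2 c0 Jf degx.
(* Precomposing with the swap of variables exchanges the two components and negates the Jacobian. *)
pose sw : endomorphism C := subst vary varx.
have sw2 : (f \o sw) \o sw =1 f.
  by apply: (@endomorphism_eq ((f \o sw) \o sw)); rewrite /= !(substx, substy).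
apply: (@invertible_ext ((f \o sw) \o sw) f sw2).
apply: (@invertible_comp (f \o sw) sw); last exact: swap_invertible.
apply: (@invertible_of_degree_le2 (f \o sw) (- c)).
- by rewrite oppr_eq0.
- by rewrite /= substx substy JacN Jf mpolyCN.
by rewrite /= substx.
Qed.

End PlaneMorphisms.

Theorem theorem3p3 (R : realType) (f : endomorphism R[i]) :
  (exists2 c : R[i], c != 0 & Jac (f varx) (f vary) = c%:MP) ->
  (total_degree (f varx) <= 2)%N \/ (total_degree (f vary) <= 2)%N ->
  invertible f.
Proof.
case=> c c0 Jf.
(* [R[i]] is a numeric field, hence of characteristic zero. *)
exact: (low_degree_invertible (Num.Theory.pchar_num R[i]) c0 Jf).
Qed.
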